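(* Let $K\ge1$ be an integer, $d=K+1$, $D_1>0$, and consider the hard instance on $\mathbb R^d$ with feasible set $\mathcal C=\{x\in\mathbb R^d:\|x\|_2\le D_1\}$ and preference relation realized by $f$ (as defined in the context). Every $K$-step normal-direction span-based method on this instance starting from $x_1=z_1=0$ has output $\hat x$ satisfying $$\Delta_{\mathrm{LS}}(\hat x)\ \ge\ \frac{3\,\operatorname{dist}(x_1,\mathcal X^\star)}{4\sqrt{K+1}} .$$
   Context: Hard instance. Let $h_{\max}(x)=\max_{1\le i\le d}x_i$ on $\mathbb R^d$. Let $\rho:\mathbb R^d\to\mathbb R$ be any nonnegative $C^\infty$ function with $\int_{\mathbb R^d}\rho(z)\,dz=1$ and $\{z:\rho(z)>0\}\subseteq\{z\in\mathbb R^d:0<z_d<z_{d-1}<\cdots<z_1<1\}$. Put $\chi=D_1/(4\sqrt d)$, $\rho_\chi(z)=\chi^{-d}\rho(z/\chi)$, and $f(x)=\int_{\mathbb R^d}h_{\max}(x+z)\rho_\chi(z)\,dz$. The preference relation is $x\preccurlyeq y\iff f(x)\le f(y)$ for $x,y\in\mathbb R^d$; $x\sim y$ iff $f(x)=f(y)$. $\mathcal X^\star=\{x\in\mathcal C:x\preccurlyeq y\ \forall y\in\mathcal C\}$, $\mathcal L_x=\{y\in\mathbb R^d:y\sim x\}$, and the level-set optimality gap is $\Delta_{\mathrm{LS}}(x)=\operatorname{dist}(\mathcal X^\star,\mathcal L_x)$ (Euclidean distance between sets, infimum). The function $f$ is differentiable with $\nabla f\neq0$ everywhere, and the normal direction at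 $x$ is $n_x=\nabla f(x)/\|\nabla f(x)\|_2$. A $K$-step normal-direction span-based method maintains internal points $z_1,\dots,z_{K+1}\in\mathbb R^d$ and feasible points $x_t=\Pi_{\mathcal C}(z_t)$ (Euclidean projection), $t=1,\dots,K+1$. At each iteration $t=1,\dots,K$ it receives $n_t:=n_{x_t}$ and then chooses the next internal point in any way such that $z_{t+1}\in z_1+\operatorname{span}\{n_1,\dots,n_t,\ x_1-z_1,\dots,x_t-z_t\}$. After $K$ iterations it may output any $\hat x\in\{x_1,\dots,x_{K+1}\}$. *)

(* Defs.v *)
From HB Require Import structures.
From mathcomp Require Import all_boot all_order all_algebra.
From mathcomp Require Import all_classical all_reals all_analysis.

Set Implicit Arguments.
Unset Strict Implicit.
Unset Printing Implicit Defensive.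

Import Order.TTheory GRing.Theory Num.Theory.
Import numFieldNormedType.Exports.

Local Open Scope classical_set_scope.
Local Open Scope ring_scope.

Section ConsMeasure.
Context {R : realType} (n : nat).
Local Notation mR := (measurableTypeR R).

Definition cons_pair (p : mR * n.-tuple mR) : n.+1.-tuple mR :=
  [tuple of p.1 :: p.2].

Definition uncons_tuple (t : n.+1.-tuple mR) : mR * n.-tuple mR :=
  (tnth t ord0, [tuple of behead t]).

Lemma cons_pairK : cancel cons_pair uncons_tuple.
Proof. by case=> a t; congr pair; apply/val_inj. Qed.

Lemma measurable_cons_pair : measurable_fun setT cons_pair.
Proof. exact: measurable_cons. Qed.

Lemma measurable_uncons_tuple : measurable_fun setT uncons_tuple.
Proof.
apply/measurable_fun_pair; [exact: measurable_tnth|exact: measurable_behead].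
Qed.

Variable m : {sigma_finite_measure set (n.-tuple mR) -> \bar R}.

Definition cons_measure : set (n.+1.-tuple mR) -> \bar R :=
  pushforward (lebesgue_measure \x m)%E cons_pair.

Let nu : {measure set (n.+1.-tuple mR) -> \bar R} :=
  measure_function_pushforward__canonical__measure_function_Measure
    (lebesgue_measure \x m)%E measurable_cons_pair.

Let cons_measure0 : cons_measure set0 = 0%E.
Proof. exact: (measure0 nu). Qed.

Let cons_measure_ge0 A : (0 <= cons_measure A)%E.
Proof. exact: (measure_ge0 nu). Qed.

Let cons_measure_sigma_additive : semi_sigma_additive cons_measure.
Proof. exact: (@measure_semi_sigma_additive _ _ _ nu). Qed.

HB.instance Definition _ := isMeasure.Build _ _ _ cons_measure
  cons_measure0 cons_measure_ge0 cons_measure_sigma_additive.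

Let cons_measure_sigma_finite : sigma_finite setT cons_measure.
Proof.
have /sigma_finiteP[F [FT Fnd Foo]] := sigma_finiteT (@lebesgue_measure R).
have /sigma_finiteP[G [GT Gnd Goo]] := sigma_finiteT m.
exists (fun i => uncons_tuple @^-1` (F i `*` G i)).
  rewrite -preimage_bigcup -(preimage_setT uncons_tuple); congr (_ @^-1` _).
  apply/esym; rewrite -subTset => -[a t] _.
  have : (\bigcup_i F i) a by rewrite -FT.
  have : (\bigcup_i G i) t by rewrite -GT.
  move=> [j _ Gt] [i _ Fa]; exists (maxn i j) => //; split.
    by move: a Fa; exact/subsetPset/Fnd/leq_maxl.
  by move: t Gt; exact/subsetPset/Gnd/leq_maxr.
move=> i; have [mF Fi] := Foo i; have [mG Gi] := Goo i.
have mFG : measurable (F i `*` G i) by exact: measurableX.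
split; first by rewrite -[X in measurable X]setTI; exact: measurable_uncons_tuple.
rewrite /cons_measure /pushforward -comp_preimage (_ : _ \o _ = id); last first.
  by apply/funext => x; exact: cons_pairK.
by rewrite preimage_id product_measure1E// lte_mul_pinfty// ge0_fin_numE.
Qed.

HB.instance Definition _ := Measure_isSigmaFinite.Build _ _ _ cons_measure
  cons_measure_sigma_finite.

End ConsMeasure.

(* Lebesgue measure on the Borel sets of R^n, the points of R^n being
   n-tuples: the n-fold product of the one-dimensional Lebesgue measure,
   transported at each step along the isomorphism R * R^n -> R^(n+1). *)
Fixpoint lebesgue_tuple {R : realType} (n : nat) :
    {sigma_finite_measure set (n.-tuple (measurableTypeR R)) -> \bar R} :=
  if n is n'.+1 then cons_measure (lebesgue_tuple n')
  else \d_([tuple] : 0.-tuple (measurableTypeR R)).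

Section EuclideanSpace.
Context {R : realType} {n : nat}.
Implicit Types (x y : 'rV[R]_n) (f : 'rV[R]_n -> R) (A B : set 'rV[R]_n).

(* The norm that the library puts on row vectors is the sup norm, hence the
   explicit Euclidean norm; the two define the same topology. *)
Definition enorm x : R := Num.sqrt (\sum_i x 0 i ^+ 2).

(* The library sets inf set0 = 0 (not +oo), so this is the distance between
   nonempty sets only. *)
Definition set_dist A B : R := inf [set enorm (x - y) | x in A & y in B].

Definition is_proj A x y : Prop :=
  A y /\ forall w, A w -> enorm (x - y) <= enorm (x - w).

Definition rV_integral f : R :=
  (\int[lebesgue_tuple n]_t f (\row_i tnth t i))%R.

Definition partial (i : 'I_n) f x : R := 'D_(delta_mx 0 i) f x.

Definition grad f x : 'rV[R]_n := \row_i partial i f x.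

Fixpoint Ck (k : nat) f : Prop :=
  continuous f /\
  if k is k'.+1 then
    forall i, (forall x, derivable f x (delta_mx 0 i)) /\ Ck k' (partial i f)
  else True.

Definition smooth f : Prop := forall k, Ck k f.

Definition pref f x y : Prop := f x <= f y.

Definition indiff f x y : Prop := f x = f y.

Definition minimizers f A : set 'rV[R]_n :=
  [set x | A x /\ forall y, A y -> pref f x y].

Definition level_set f x : set 'rV[R]_n := [set y | indiff f y x].

Definition level_gap f A x : R := set_dist (minimizers f A) (level_set f x).

Definition normal_dir f x : 'rV[R]_n := (enorm (grad f x))^-1 *: grad f x.

(* A run of a K-step method: only the values of the sequences z and x at the
   indices 1, ..., K+1 matter. *)
Definition span_based_run (K : nat) f A (z x : nat -> 'rV[R]_n) : Prop :=
  (forall t, (1 <= t <= K.+1)%N -> is_proj A (z t) (x t)) /\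
  (forall t, (1 <= t <= K)%N ->
     z t.+1 - z 1%N \in
       <<[seq normal_dir f (x s) | s <- iota 1 t] ++
         [seq x s - z s | s <- iota 1 t]>>%VS).

End EuclideanSpace.

Section HardInstance.
Context {R : realType} {n : nat}.

Definition hmax (x : 'rV[R]_n.+1) : R := \big[Num.max/x 0 ord0]_i x 0 i.

Definition ordered_simplex : set 'rV[R]_n.+1 :=
  [set z | [/\ 0 < z 0 ord_max,
               forall i j : 'I_n.+1, (i < j)%N -> z 0 j < z 0 i &
               z 0 ord0 < 1]].

Definition bandwidth (D : R) : R := D / (4 * Num.sqrt n.+1%:R).

Definition scaled (rho : 'rV[R]_n.+1 -> R) (c : R) (z : 'rV[R]_n.+1) : R :=
  c ^- n.+1 * rho (c^-1 *: z).

Definition hard_fun (rho : 'rV[R]_n.+1 -> R) (D : R) (x : 'rV[R]_n.+1) : R :=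
  rV_integral (fun z => hmax (x + z) * scaled rho (bandwidth D) z).

Definition eball (D : R) : set 'rV[R]_n.+1 := [set x | enorm x <= D].

End HardInstance.

(* Main.v *)
(* On the support of the smoothing kernel the coordinates of z decrease, so if
   x vanishes from coordinate k on, none of the coordinates after k can attain
   the maximum of x + z, and lowering one of them does not change f. Hence each
   query reveals at most one new coordinate, the projection onto a centred ball
   creates none, and after K = d - 1 steps every x_t still has last coordinate 0,
   so f(x_t) >= 0. On the other hand, with c = D1 / (4 sqrt d), the point of the
   ball with all coordinates -4c has f <= -4c + c, and f is 1-Lipschitz: every
   minimizer is at distance at least 3c from the level set of x_t, while it is at
   distance at most D1 from x_1 = 0. *)
Require Import Defs.
From HB Require Import structures.
From mathcomp Require Import all_boot all_order all_algebra.
From mathcomp Require Import all_classical all_reals all_analysis.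
From mathcomp Require Import measurable_realfun ring lra.

Import Order.TTheory GRing.Theory Num.Theory.
Import numFieldNormedType.Exports.

Local Open Scope classical_set_scope.
Local Open Scope ring_scope.

(** * Change of variables under dilations, first on the line and then on tuples *)

Section Scaling.
#[local] Set Implicit Arguments.
#[local] Unset Strict Implicit.
Context {R : realType}.
Local Notation mR := (measurableTypeR R).
Local Open Scope ereal_scope.

(** Lebesgue measure and [c] times its image under the dilation agree on half-open intervals, so
    uniqueness of Lebesgue measure identifies them and the integrals follow. *)
Lemma ge0_integral_lebesgue_scale (c : R) (g : mR -> \bar R) :
  (0 < c)%R -> measurable_fun [set: mR] g -> (forall x, 0 <= g x) ->
  c%:E * \int[lebesgue_measure]_x g (c * x)%R = \int[lebesgue_measure]_x g x.
Proof.
move=> c0 mg g0.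
have mc : measurable_fun [set: mR] (fun x : mR => (c * x)%R : mR).
  exact: mulrl_measurable.
pose push := measure_function_pushforward__canonical__measure_function_Measure
  (@lebesgue_measure R) mc.
pose k : {nonneg R} := NngNum (ltW c0).
have pushE A : measurable A -> @lebesgue_measure R A = mscale k push A.
  apply: lebesgue_measure_unique => _ [[a b] _ <-].
  change (@lebesgue_measure R `]a, b]%classic = c%:E * @lebesgue_measure R
    ((fun x : mR => (c * x)%R : mR) @^-1` `]a, b]%classic)).
  rewrite (_ : _ @^-1` _ = `](a / c)%R, (b / c)%R]%classic); last first.
    apply/seteqP; split => x /=; rewrite !in_itv/= ltr_pdivrMr// ler_pdivlMr//;
    by rewrite mulrC.
  rewrite !lebesgue_measure_itv/= !lte_fin ltr_pM2r ?invr_gt0//.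
  case: ifPn => _; last by rewrite mule0.
  by rewrite -!EFinB -EFinM -mulrBl mulrC divfK// gt_eqF.
transitivity (\int[mscale k push]_x g x).
  rewrite ge0_integral_mscale//; congr (_ * _).
  by rewrite ge0_integral_pushforward.
by apply/esym/eq_measure_integral => A mA _; exact: pushE.
Qed.

Definition scale_tuple n (c : R) (t : n.-tuple mR) : n.-tuple mR :=
  [tuple of map (fun x : mR => (c * x)%R : mR) t].

Lemma measurable_scale_tuple n c : measurable_fun setT (scale_tuple (n := n) c).
Proof.
apply/measurable_fun_tnthP => i.
rewrite (_ : _ \o _ = (fun x : mR => (c * x)%R : mR) \o @tnth n mR ^~ i).
  by apply: measurableT_comp; [exact: mulrl_measurable|exact: measurable_tnth].
by apply/funext => t /=; rewrite tnth_map.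
Qed.

Lemma ge0_integral_lebesgue_tuple_cons n (g : n.+1.-tuple mR -> \bar R) :
  measurable_fun setT g -> (forall x, 0 <= g x) ->
  \int[lebesgue_tuple n.+1]_t g t =
  \int[lebesgue_measure]_a \int[lebesgue_tuple n]_t g (cons_pair (a, t)).
Proof.
move=> mg g0.
pose push := measure_function_pushforward__canonical__measure_function_Measure
  (lebesgue_measure \x lebesgue_tuple n) (@measurable_cons_pair R n).
transitivity (\int[push]_t g t); first exact: eq_measure_integral.
have mcons : measurable_fun setT (cons_pair (R:=R) (n:=n)).
  exact: measurable_cons_pair.
rewrite ge0_integral_pushforward//.
apply: (@fubini_tonelli1 _ _ _ _ _ _ _ (g \o cons_pair (n:=n))) => //.
  exact: measurableT_comp.
by move=> p; exact: g0.
Qed.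

Lemma measurable_lebesgue_tuple_section n (g : n.+1.-tuple mR -> \bar R) :
  measurable_fun setT g -> (forall x, 0 <= g x) ->
  measurable_fun setT
    (fun a : mR => \int[lebesgue_tuple n]_t g (cons_pair (a, t))).
Proof.
move=> mg g0.
apply: (@measurable_fun_fubini_tonelli_F _ _ _ _ _ _ (g \o cons_pair (n:=n))).
  by apply: measurableT_comp => //; exact: measurable_cons_pair.
by move=> p; exact: g0.
Qed.

(** By induction on the dimension: Tonelli splits off the first coordinate, which contributes one
    factor [c], and the remaining [n] factors come from the inner integral. *)
Lemma ge0_integral_lebesgue_tuple_scale n (c : R)
    (g : n.-tuple mR -> \bar R) :
  (0 < c)%R -> measurable_fun setT g -> (forall x, 0 <= g x) ->
  (c ^+ n)%:E * \int[lebesgue_tuple n]_t g (scale_tuple c t) =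
  \int[lebesgue_tuple n]_t g t.
Proof.
move=> c0; elim: n g => [|n IHn] g mg g0.
  rewrite expr0 mul1e; apply: eq_integral => t _.
  by congr g; rewrite [LHS]tuple0 [RHS]tuple0.
have mgs : measurable_fun setT (g \o scale_tuple (n := n.+1) c).
  by apply: measurableT_comp => //; exact: measurable_scale_tuple.
rewrite (ge0_integral_lebesgue_tuple_cons mgs) => [|t]; last exact: g0.
rewrite (ge0_integral_lebesgue_tuple_cons mg)//.
have mG := measurable_lebesgue_tuple_section mg g0.
rewrite -[RHS](ge0_integral_lebesgue_scale c0 mG) => [|x]; last first.
  exact: integral_ge0.
rewrite exprS EFinM -muleA; congr (_ * _).
rewrite -ge0_integralZl//; last 3 first.
- by apply: measurable_lebesgue_tuple_section => // t; exact: g0.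
- by move=> a _; apply: integral_ge0 => t _; exact: g0.
- by rewrite lee_fin exprn_ge0// ltW.
apply: eq_integral => a _.
rewrite -(IHn (fun t => g (cons_pair ((c * a)%R, t))))//.
  congr (_ * _); apply: eq_integral => t _ /=; congr g; exact: val_inj.
apply: (measurableT_comp (f := g)) => //.
apply: (measurableT_comp (f := cons_pair (n:=n))) => //.
exact: measurable_cons_pair.
Qed.

End Scaling.

(** * Continuous functions of row vectors are measurable on tuples *)

Section Measurability.
#[local] Set Implicit Arguments.
#[local] Unset Strict Implicit.
Context {R : realType} {n : nat}.
Local Notation mR := (measurableTypeR R).

Definition row_of_tuple (t : n.-tuple mR) : 'rV[R]_n := \row_i tnth t i.

(** A countable base of the topology. Sup-norm balls are products of intervals, so their preimages
    are finite intersections of measurable cylinders. *)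
Let rational_box (p : 'rV[rat]_n * nat) : set 'rV[R]_n :=
  ball (map_mx ratr p.1 : 'rV[R]_n) p.2.+1%:R^-1.

Let open_bigcup_rational_box (U : set 'rV[R]_n) : open U ->
  U = \bigcup_(p in [set p | rational_box p `<=` U]) rational_box p.
Proof.
rewrite openE => oU; apply/seteqP; split => [x Ux|x [p pU]]; last exact: pU.
have /nbhs_ballP[e/= e0 xeU] := oU _ Ux.
(* The centre of the box is only near [x], so its radius must fit twice into [e]. *)
have [k ke] : exists k, k.+1%:R^-1 < e / 2 :> R.
  exists (Num.truncn (e / 2)^-1).
  rewrite -[ltRHS]invrK ltf_pV2 ?posrE ?invr_gt0 ?divr_gt0//.
  exact: truncnS_gt.
have /choice[q qx] i : exists r : rat, ball (x 0 i) k.+1%:R^-1 (ratr r : R).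
  have xk : (0 : R) < k.+1%:R^-1 by rewrite invr_gt0.
  have [y [xy [r _ rE]]] := @dense_rat R (ball (x 0 i) k.+1%:R^-1)
    (ex_intro _ _ (ballxx (x 0 i) xk)) (ball_open _ _).
  by exists r; rewrite rE.
have qxk : rational_box (\row_i q i, k) x.
  split=> // i j; rewrite !mxE (ord1 i); exact/ball_sym/qx.
exists (\row_i q i, k) => //= y /= qy; apply: xeU.
rewrite [e]splitr.
apply: (@ball_triangle _ _ (map_mx ratr (\row_i q i) : 'rV[R]_n)).
  by apply: ball_sym; apply: le_ball qxk; exact: ltW.
by apply: le_ball qy; exact: ltW.
Qed.

Lemma measurable_preimage_row_of_tuple (U : set 'rV[R]_n) : open U ->
  measurable (row_of_tuple @^-1` U).
Proof.
move=> oU; rewrite (open_bigcup_rational_box oU) preimage_bigcup.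
rewrite bigcup_mkcond.
apply: countable_bigcupT_measurable => [|[q k]/=]; first exact: countableP.
case: ifPn => _ //.
rewrite (_ : _ @^-1` _ = \bigcap_(i in [set: 'I_n])
    ((fun t : n.-tuple mR => tnth t i) @^-1` ball (ratr (q 0 i) : R) k.+1%:R^-1)).
  apply: fin_bigcap_measurable => // i _.
  rewrite -[X in measurable X]setTI.
  apply: (measurable_tnth i) => //.
  exact: measurable_ball.
apply/seteqP; split => t /=.
  by move=> [_ qt] i _; have := qt 0 i; rewrite !mxE.
by move=> qt; split => // i j; rewrite !mxE (ord1 i); exact: qt.
Qed.

Lemma measurable_continuous_row (g : 'rV[R]_n -> R) : continuous g ->
  measurable_fun setT (g \o row_of_tuple).
Proof.
move=> /continuousP cg; apply: (measurability _ (RGenOpens.measurableE R)).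
move=> _ [_ [a [b ->] <-]]; rewrite setTI comp_preimage.
apply: measurable_preimage_row_of_tuple; apply: cg; exact: interval_open.
Qed.

End Measurability.

(** * Euclidean norm, coordinate subspaces and projection onto the ball *)

Section Euclidean.
#[local] Set Implicit Arguments.
#[local] Unset Strict Implicit.
Context {R : realType} {n : nat}.
Implicit Types x y z : 'rV[R]_n.

Lemma enorm_ge0 x : 0 <= enorm x.
Proof. exact: sqrtr_ge0. Qed.

Lemma normr_le_enorm x i : `|x 0 i| <= enorm x.
Proof.
rewrite -sqrtr_sqr ler_wsqrtr// (bigD1 i)//= lerDl.
by apply: sumr_ge0 => j _; exact: sqr_ge0.
Qed.

Lemma enormN x : enorm (- x) = enorm x.
Proof. by congr Num.sqrt; apply: eq_bigr => i _; rewrite mxE sqrrN. Qed.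

Lemma enorm_const (a : R) : 0 <= a ->
  enorm (const_mx a : 'rV[R]_n) = Num.sqrt n%:R * a.
Proof.
move=> a0; rewrite /enorm; under eq_bigr do rewrite mxE.
by rewrite sumr_const card_ord -[_ *+ n]mulr_natl sqrtrM// sqrtr_sqr ger0_norm.
Qed.

(** With indices starting at 0, this is the span of the first [k] basis vectors. *)
Definition vanishes_from (k : nat) x := forall i : 'I_n, (k <= i)%N -> x 0 i = 0.

Lemma vanishes_from_le k l x :
  (k <= l)%N -> vanishes_from k x -> vanishes_from l x.
Proof. by move=> kl xk i li; apply: xk; exact: leq_trans li. Qed.

Lemma vanishes_from_span k (s : seq 'rV[R]_n) x :
  (forall y, y \in s -> vanishes_from k y) -> x \in span s ->
  vanishes_from k x.
Proof.
move=> sk /(@coord_span _ _ _ (in_tuple s)) -> i ki.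
rewrite summxE big1// => j _; rewrite mxE (sk _ _ i ki) ?mulr0//.
exact: mem_nth.
Qed.

(** If [x] had a nonzero coordinate past [k], zeroing all of those would keep it in the ball and
    bring it strictly closer to [z]. Arguing by minimality avoids a formula for the projection. *)
Lemma vanishes_from_proj k (D : R) z x :
  vanishes_from k z -> is_proj [set y | enorm y <= D] z x -> vanishes_from k x.
Proof.
move=> zk [xD xmin] i ki; apply/eqP/contraT => xi.
pose w : 'rV[R]_n := \row_j (if (j < k)%N then x 0 j else 0).
have wx : enorm w <= enorm x.
  rewrite ler_wsqrtr//; apply: ler_sum => j _; rewrite mxE.
  by case: ifPn => // _; rewrite expr0n/= sqr_ge0.
have := xmin w (le_trans wx xD).
(* Strict monotonicity of the root needs a positive right-hand sum; coordinate [i] supplies it, and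
   also the strict gap between the two sums. *)
rewrite leNgt => /negP[]; rewrite ltr_sqrt; last first.
  rewrite (bigD1 i)//= ltr_pwDl//; last by apply: sumr_ge0 => j _; exact: sqr_ge0.
  by rewrite !mxE (zk _ ki) sub0r exprn_even_gt0//= oppr_eq0.
rewrite (bigD1 i)//= [ltRHS](bigD1 i)//= ltr_leD//.
  rewrite !mxE ltnNge ki/= (zk _ ki) subr0 expr0n/= sub0r.
  by rewrite exprn_even_gt0//= oppr_eq0.
apply: ler_sum => j _; rewrite !mxE; case: ifPn => // jk.
have -> : z 0 j = 0 by apply: zk; rewrite leqNgt.
by rewrite subrr expr0n/= sqr_ge0.
Qed.

End Euclidean.

(** * The maximum of the coordinates *)

Section Hmax.
#[local] Set Implicit Arguments.
#[local] Unset Strict Implicit.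
Context {R : realType} {n : nat}.
Implicit Types x y z : 'rV[R]_n.+1.

Lemma le_hmax x i : x 0 i <= hmax x.
Proof. by rewrite /hmax (bigmaxD1 i)//= le_max lexx. Qed.

Lemma hmax_le x c : (forall i, x 0 i <= c) -> hmax x <= c.
Proof. by move=> xc; apply/bigmax_le. Qed.

Lemma hmaxD_le x y c : (forall i, x 0 i <= y 0 i + c) -> hmax x <= hmax y + c.
Proof.
by move=> xy; apply: hmax_le => i; rewrite (le_trans (xy i))// lerD2r le_hmax.
Qed.

(** Moving every coordinate by at most [e] moves the maximum by at most [e], and balls here are
    sup-norm balls. *)
Lemma hmax_continuous : continuous (@hmax R n).
Proof.
move=> x; apply/(@cvgrPdist_le _ _ _ (nbhs x)) => e e0.
apply/nbhs_ballP; exists e => //= y [_ xy].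
have {}xy i : `|x 0 i - y 0 i| <= e by exact/ltW/xy.
rewrite ler_distl; apply/andP; split.
  rewrite lerBlDr; apply: hmaxD_le => i.
  by have := xy i; rewrite ler_distlC => /andP[_].
by apply: hmaxD_le => i; have := xy i; rewrite ler_distl => /andP[_].
Qed.

(** Coordinate [k] is untouched and dominates coordinate [i], so the maximum is reached away from
    [i] both before and after the move. *)
Lemma hmax_lower x (h : R) i k :
  h <= 0 -> x 0 i <= x 0 k -> i != k ->
  hmax (x + h *: delta_mx 0 i) = hmax x.
Proof.
move=> h0 xik ik.
have xE j : (x + h *: delta_mx 0 i) 0 j = x 0 j + h * (j == i)%:R.
  by rewrite !mxE eqxx.
apply/le_anti/andP; split; apply: hmax_le => j.
  rewrite xE (le_trans _ (le_hmax x j))// gerDl mulr_le0_ge0//.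
have [->|ji] := eqVneq j i.
  apply: (le_trans xik); apply: le_trans (le_hmax _ k).
  by rewrite xE eq_sym (negbTE ik) mulr0 addr0.
apply: le_trans (le_hmax _ j).
by rewrite xE (negbTE ji) mulr0 addr0.
Qed.

End Hmax.

(** * The smoothed maximum, for an arbitrary kernel width [c] *)

Section HardFunction.
#[local] Set Implicit Arguments.
#[local] Unset Strict Implicit.
Context {R : realType} {n : nat}.
Local Notation mR := (measurableTypeR R).
Context (rho : 'rV[R]_n.+1 -> R) (c : R).
Context (c0 : 0 < c) (rho_cont : continuous rho).
Context (rho_ge0 : forall z, 0 <= rho z) (rho_int : rV_integral rho = 1).
Context (rho_supp : [set z | 0 < rho z] `<=` ordered_simplex).
Implicit Types x y z : 'rV[R]_n.+1.

Local Notation w := (scaled rho c).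
Local Notation F := (fun x => rV_integral (fun z => hmax (x + z) * w z)).

Let w_ge0 z : 0 <= w z.
Proof. by rewrite mulr_ge0// invr_ge0 exprn_ge0// ltW. Qed.

Let w_cont : continuous w.
Proof.
move=> z; apply: (@continuousM _ _ (cst (c ^- n.+1)) (fun z => rho (c^-1 *: z))).
  exact: cst_continuous.
apply: (@continuous_comp _ _ _ (fun z => c^-1 *: z) rho).
  exact: scaler_continuous.
exact: rho_cont.
Qed.

(** The support is the simplex dilated by [c]; the ordering carries the bounds on the two end
    coordinates over to all of them. *)
Let w_supp z : w z != 0 ->
  [/\ forall i, 0 <= z 0 i, forall i, z 0 i <= c &
      forall i j : 'I_n.+1, (i < j)%N -> z 0 j <= z 0 i].
Proof.
rewrite mulf_eq0 negb_or => /andP[_ rz0].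
have [] : ordered_simplex (c^-1 *: z).
  by apply: rho_supp => /=; rewrite lt_neqAle eq_sym rz0 rho_ge0.
rewrite !mxE => zn0 zij z01.
have mono (i j : 'I_n.+1) : (i <= j)%N -> z 0 j <= z 0 i.
  rewrite leq_eqVlt => /predU1P[/val_inj ->//|/zij].
  by rewrite !mxE ltr_pM2l ?invr_gt0// => /ltW.
split=> [i|i|i j /ltnW/mono//].
  apply: le_trans (mono i ord_max (leq_ord i)).
  by move: zn0; rewrite pmulr_rgt0 ?invr_gt0// => /ltW.
apply: le_trans (mono ord0 i isT) _.
by move: z01; rewrite mulrC ltr_pdivrMr// mul1r => /ltW.
Qed.

(** Dilation by the inverse of [c]: its Jacobian is exactly the normalizing factor in [scaled]. *)
Let integral_w : (\int[lebesgue_tuple n.+1]_t (w (row_of_tuple t))%:E = 1)%E.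
Proof.
have int_rho : (\int[lebesgue_tuple n.+1]_t (rho (row_of_tuple t))%:E = 1)%E.
  move: rho_int; rewrite /rV_integral /Rintegral -/(row_of_tuple _).
  (* The real-valued integral sends infinite values to 0, so being 1 forces finiteness. *)
  case: (integral _ _ _) => [r /= ->//| |] /= /eqP;
  by rewrite eq_sym oner_eq0.
have mrho := measurable_continuous_row rho_cont.
rewrite -int_rho -[RHS](@ge0_integral_lebesgue_tuple_scale _ _ c^-1)//;
  last 3 first.
- by rewrite invr_gt0.
- exact/measurable_EFinP.
- by move=> t; rewrite lee_fin.
rewrite -ge0_integralZl//; last 3 first.
- apply/measurable_EFinP; apply: (measurableT_comp mrho).
  exact: measurable_scale_tuple.
- by move=> t _; rewrite lee_fin.
- by rewrite lee_fin exprn_ge0// invr_ge0 ltW.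
apply: eq_integral => t _; rewrite -EFinM exprVn; congr (_ * rho _)%:E.
by apply/rowP => i; rewrite !mxE tnth_map.
Qed.

(** Domination by [M * w]; a bound on the support of [w] is enough because the product is zero
    elsewhere. *)
Let integrable_w (g : 'rV[R]_n.+1 -> R) : continuous g ->
  (exists M, forall z, w z != 0 -> `|g z| <= M) ->
  (lebesgue_tuple n.+1).-integrable setT
    (EFin \o (fun t => g (row_of_tuple t) * w (row_of_tuple t))).
Proof.
move=> cg [M gM].
have mw := measurable_continuous_row w_cont.
have iw : (lebesgue_tuple n.+1).-integrable setT (EFin \o (w \o row_of_tuple)).
  apply/integrableP; split; first exact/measurable_EFinP.
  under eq_integral do rewrite /= ger0_norm//.
  by rewrite integral_w ltry.
apply: (le_integrable _ _ _ (integrableZl _ M iw)) => //.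
  apply/measurable_EFinP/measurable_funM => //.
  exact: measurable_continuous_row.
move=> t _ /=; rewrite lee_fin [leLHS]normrM [leRHS]normrM.
have [->|w0] := eqVneq (w (row_of_tuple t)) 0; first by rewrite normr0 !mulr0.
by rewrite ler_wpM2r// (le_trans (gM _ w0))// ler_norm.
Qed.

Let integrable_hmax x : (lebesgue_tuple n.+1).-integrable setT
  (EFin \o (fun t => hmax (x + row_of_tuple t) * w (row_of_tuple t))).
Proof.
apply: (@integrable_w (fun z => hmax (x + z))) => [z|].
  apply: (@continuous_comp _ _ _ (fun z => x + z) (@hmax R n)).
    by apply: continuousD; [exact: cst_continuous|exact: cvg_id].
  exact: hmax_continuous.
exists (enorm x + c) => z /w_supp[z0 zc _].
have xz i := normr_le_enorm x i.
rewrite ler_norml; apply/andP; split.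
  apply: le_trans (le_hmax _ ord0); rewrite mxE opprD lerD//.
    by have := xz ord0; rewrite ler_norml => /andP[].
  by rewrite (le_trans _ (z0 ord0))// oppr_le0 ltW.
apply: hmax_le => i; rewrite mxE lerD//.
by have := xz i; rewrite ler_norml => /andP[].
Qed.

Let integrable_wZ a : (lebesgue_tuple n.+1).-integrable setT
  (EFin \o (fun t => a * w (row_of_tuple t))).
Proof.
by apply: (@integrable_w (cst a)) => [|]; [exact: cst_continuous|exists `|a|].
Qed.

Let Rintegral_wZ a :
  (\int[lebesgue_tuple n.+1]_t (a * w (row_of_tuple t)))%R = a.
Proof.
rewrite RintegralZl//; last first.
  by have := integrable_wZ 1; under eq_fun do rewrite /= mul1r.
by rewrite /Rintegral integral_w/= mulr1.
Qed.

(** Since [w] has mass 1, the constant [a] is the integral of [a * w], and the integrands compare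
    pointwise. *)
Lemma hard_fun_le_shift x y a :
  (forall z, w z != 0 -> hmax (x + z) <= hmax (y + z) + a) -> F x <= F y + a.
Proof.
move=> xya; rewrite -[X in _ + X]Rintegral_wZ /F /rV_integral -RintegralD//.
apply: le_Rintegral => //.
  have := integrableD measurableT (integrable_hmax y) (integrable_wZ a).
  exact.
move=> t _; rewrite -mulrDl -/(row_of_tuple _).
have [->|w0] := eqVneq (w (row_of_tuple t)) 0; first by rewrite !mulr0.
by rewrite ler_wpM2r//; exact: xya.
Qed.

Lemma hard_fun_lipschitz x y : F x <= F y + enorm (x - y).
Proof.
apply: hard_fun_le_shift => z _; apply: hmaxD_le => i.
rewrite !mxE addrAC lerD2r -lerBlDl.
by have := normr_le_enorm (x - y) i; rewrite !mxE; apply: le_trans (ler_norm _).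
Qed.

Lemma hard_fun_ge0 x : x 0 ord_max = 0 -> 0 <= F x.
Proof.
move=> xn; apply: Rintegral_ge0 => t _.
have [->|/w_supp[z0 _ _]] := eqVneq (w (row_of_tuple t)) 0.
  by rewrite mulr0.
rewrite mulr_ge0// (le_trans _ (le_hmax _ ord_max))//.
by rewrite mxE xn add0r z0.
Qed.

Lemma hard_fun_le_const x a : (forall i, x 0 i <= a) -> F x <= a + c.
Proof.
move=> xa; rewrite -[leRHS]Rintegral_wZ; apply: le_Rintegral => // t _.
have [->|/w_supp[_ zc _]] := eqVneq (w (row_of_tuple t)) 0.
  by rewrite !mulr0.
by rewrite ler_wpM2r//; apply: hmax_le => i; rewrite mxE lerD.
Qed.

(** [x] is zero at both [k] and [i], so on the support of [w] the ordering of [z] makes coordinate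
    [k] of [x + z] dominate coordinate [i]; then [hmax_lower] applies under the integral. *)
Lemma hard_fun_lower x (k : nat) (i : 'I_n.+1) h :
  vanishes_from k x -> (k < i)%N -> h <= 0 -> F (x + h *: delta_mx 0 i) = F x.
Proof.
move=> xk ki h0; apply: eq_Rintegral => t _.
have [->|/w_supp[_ _ zmono]] := eqVneq (w (row_of_tuple t)) 0.
  by rewrite !mulr0.
have kn : (k < n.+1)%N by exact: ltn_trans ki (ltn_ord i).
congr (_ * _); rewrite addrAC (@hmax_lower _ _ _ _ _ (Ordinal kn))//.
  rewrite !mxE (xk i (ltnW ki)) (xk (Ordinal kn))// !add0r.
  by have := zmono (Ordinal kn) i ki; rewrite !mxE.
by apply: contraTneq ki => ->; rewrite ltnn.
Qed.

(* When the limit defining the partial derivative does not exist, its value is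
   the default element 0 of R, so differentiability plays no role. *)
Lemma vanishes_from_normal_dir x (k : nat) :
  vanishes_from k x -> vanishes_from k.+1 (normal_dir F x).
Proof.
move=> xk i ki; rewrite !mxE /partial.
suff -> : 'D_(delta_mx 0 i) F x = 0 by rewrite mulr0.
pose q h := h^-1 *: ((F \o shift x) (h *: delta_mx 0 i) - F x).
have [cv|/dvgP] := pselect (cvg (q @ 0^')); last exact.
(* An existing limit may be computed from the left, where the quotient is identically 0; raising the
   coordinate could change the maximum. *)
rewrite [LHS](cvg_at_leftE q 0 cv); apply: cvg_lim => //.
apply: (cvg_trans (near_eq_cvg _) (cvg_cst 0)); near=> h.
have h0 : h <= 0 by near: h; exact: nbhs_left_le.
have FE := hard_fun_lower xk ki h0.
by rewrite /q /= [h *: _ + x]addrC [X in X - _]FE subrr scaler0.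
Unshelve. all: by end_near. Qed.

End HardFunction.

(** * Coordinates reached by a run, and the lower bound *)

Lemma span_based_run_vanishes {R : realType} {K : nat}
    {f : 'rV[R]_K.+1 -> R} {D : R} {z x : nat -> 'rV[R]_K.+1} :
  (forall y k, vanishes_from k y -> vanishes_from k.+1 (normal_dir f y)) ->
  span_based_run K f (eball D) z x -> z 1%N = 0 ->
  forall t, (1 <= t <= K.+1)%N -> vanishes_from t.-1 (x t).
Proof.
move=> f_chain [proj span] z1 t.
(* Strong induction on the number [s] of completed iterations: the next span involves every earlier
   [z] and [x]. *)
suff zx s : (s <= K)%N -> forall r, (1 <= r <= s.+1)%N ->
    vanishes_from r.-1 (z r) /\ vanishes_from r.-1 (x r).
  by case: t => // t /= tK; have [] := zx t tK t.+1; rewrite ?leqnn.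
elim: s => [_ r|s IHs sK r].
  case: r => [|[|r]]//= _; have z0 : vanishes_from 0 (z 1%N).
    by rewrite z1 => i _; rewrite mxE.
  by split=> //; apply: vanishes_from_proj (z0) (proj 1%N _).
move=> /andP[r0]; rewrite leq_eqVlt => /predU1P[->/=|rs]; last first.
  by apply: IHs (ltnW sK) _ _; rewrite r0.
have zs : vanishes_from s.+1 (z s.+2).
  (* The normal at iterate [r'] vanishes from [r'], one later than the iterate itself, and [r'] is
     at most [s.+1]; the residuals [x - z] gain no coordinate. *)
  have := span s.+1 sK; rewrite z1 subr0; apply: vanishes_from_span => y.
  rewrite mem_cat => /orP[] /mapP[r'];
    rewrite mem_iota add1n ltnS => r's ->;
    have [zr' xr'] := IHs (ltnW sK) r' r's;
    case: r' r's zr' xr' => // r' r's zr' xr'.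
    by apply: vanishes_from_le (f_chain _ _ xr').
  move=> i si; have r'i : (r' <= i)%N.
    by have /andP[_ /ltnW r's'] := r's; exact: leq_trans r's' si.
  by rewrite !mxE (zr' i r'i) (xr' i r'i) subrr.
by split=> //; apply: vanishes_from_proj (zs) (proj s.+2 _); rewrite ltnS.
Qed.

Theorem theorem4p23 (R : realType) (K : nat) (hK : (1 <= K)%N)
    (D1 : R) (hD1 : 0 < D1)
    (rho : 'rV[R]_K.+1 -> R)
    (rho_smooth : smooth rho)
    (rho_ge0 : forall z, 0 <= rho z)
    (rho_int : rV_integral rho = 1)
    (rho_supp : [set z | 0 < rho z] `<=` ordered_simplex)
    (z x : nat -> 'rV[R]_K.+1)
    (run : span_based_run K (hard_fun rho D1) (eball D1) z x)
    (z1 : z 1%N = 0) (x1 : x 1%N = 0)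
    (xhat : 'rV[R]_K.+1)
    (hxhat : exists2 t : nat, (1 <= t <= K.+1)%N & xhat = x t) :
  3 * set_dist [set x 1%N] (minimizers (hard_fun rho D1) (eball D1))
      / (4 * Num.sqrt K.+1%:R)
    <= level_gap (hard_fun rho D1) (eball D1) xhat.
Proof.
set f := hard_fun rho D1; set c := bandwidth (n := K) D1.
have d0 : 0 < Num.sqrt K.+1%:R :> R by rewrite sqrtr_gt0.
have c0 : 0 < c by rewrite divr_gt0// mulr_gt0.
have rho_cont : continuous rho by have [] := rho_smooth 0.
have f_lip := hard_fun_lipschitz c0 rho_cont rho_ge0 rho_int rho_supp.
have f_ge0 := hard_fun_ge0 c0 rho_ge0 rho_supp.
have f_le := hard_fun_le_const c0 rho_cont rho_ge0 rho_int rho_supp.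
have f_chain := vanishes_from_normal_dir c0 rho_ge0 rho_supp.
have f_xhat : 0 <= f xhat.
  have [t tK ->] := hxhat; apply: f_ge0.
  apply: (span_based_run_vanishes f_chain run z1 _ tK).
  (* Here [t.-1] is at most [K], the index of the last coordinate. *)
  by case: t tK.
have f_min y : minimizers f (eball D1) y -> f y <= - (3 * c).
  move=> [_ /(_ (const_mx (- (4 * c))))] ymin.
  (* This puts the constant test vector exactly on the sphere of radius [D1]. *)
  have cE : 4 * c = D1 / Num.sqrt K.+1%:R.
    by rewrite /c /bandwidth; field; rewrite gt_eqF.
  have : eball D1 (const_mx (- (4 * c)) : 'rV[R]_K.+1).
    rewrite /eball/= (_ : const_mx _ = - const_mx (4 * c)); last first.
      by apply/rowP => i; rewrite !mxE.
    rewrite enormN enorm_const; last by rewrite mulr_ge0// ltW.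
    by rewrite cE mulrCA mulfV ?mulr1// gt_eqF.
  move=> /ymin/le_trans; apply.
  have := f_le (const_mx (- (4 * c))) (- (4 * c)).
  rewrite (_ : - (4 * c) + c = - (3 * c)); last by ring.
  by apply=> i; rewrite mxE.
have gap y v : minimizers f (eball D1) y -> level_set f xhat v ->
    3 * c <= enorm (y - v).
  move=> /f_min fy fv; have := f_lip v y.
  rewrite -[X in X <= _]/(f v) -[X in _ <= X + _]/(f y) fv -enormN opprB.
  by move: f_xhat; lra.
(* Without minimizers both distances are [inf set0], that is 0, so no compactness argument is called
   for. *)
have [min0|/set0P[y0 y0min]] := eqVneq (minimizers f (eball D1)) set0.
  rewrite /level_gap /set_dist !min0.
  rewrite (_ : [set _ | _ in [set x 1%N] & _ in set0] = set0); last first.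
    by rewrite -subset0 => r [? _ [? []]].
  rewrite (_ : [set _ | _ in set0 & _ in _] = set0); last first.
    by rewrite -subset0 => r [? []].
  by rewrite inf0 mulr0 mul0r.
have dist0 : set_dist [set x 1%N] (minimizers f (eball D1)) <= D1.
  have [y0D _] := y0min.
  apply: le_trans y0D; apply: inf_lbound.
    by exists 0 => _ [? _ [? _ <-]]; exact: enorm_ge0.
  by exists (x 1%N) => //; exists y0 => //; rewrite x1 sub0r enormN.
apply: lb_le_inf.
  (* The infimum is over a nonempty set, as [xhat] lies on its own level set. *)
  by exists (enorm (y0 - xhat)), y0 => //; exists xhat.
move=> _ [y ymin [v fv <-]]; apply: le_trans (gap y v ymin fv).
(* By the choice of bandwidth, [3 * c] is the claimed bound with the distance replaced by [D1]. *)
by rewrite /c /bandwidth mulrA ler_pM2r ?invr_gt0 ?mulr_gt0// ler_pM2l.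
Qed.
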